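(* Let $A:\operatorname{D}(A)\to\mathcal H$ be a self-adjoint operator on a Hilbert space $\mathcal H$, let $\mathcal L\subset \operatorname{D}(A)$ be a finite-dimensional subspace with $n=\dim\mathcal L$, and let $j\in\{1,\dots,n\}$. Let $t^-<t<t^+$ be real numbers. Then $$F_{\mathcal L}^j(t^-)\leq t-t^- \ \Rightarrow\ t^- - F^j_{\mathcal L}(t^-)\leq \mathfrak n_j^-(t),\qquad F_{\mathcal L}^j(t^+)\leq t^+-t \ \Rightarrow\ t^+ + F^j_{\mathcal L}(t^+)\geq \mathfrak n_j^+(t).$$ Moreover, let $t_1^-<t_2^-<t<t_2^+<t_1^+$. Then $$F^j_{\mathcal L}(t_{i}^-)\leq t-t_i^-\ \text{ for } i=1,2 \ \Rightarrow\ t_1^- -F^j_{\mathcal L}(t_1^-)\leq t_2^- - F^j_{\mathcal L}(t_2^-)\leq \mathfrak n_j^-(t),$$ $$F^j_{\mathcal L}(t_i^+)\leq t_i^+-t \ \text{ for } i=1,2 \ \Rightarrow\ t_1^+ + F^j_{\mathcal L}(t_1^+)\geq t_2^+ + F^j_{\mathcal L}(t_2^+)\geq \mathfrak n_j^+(t).$$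
   Context: For $s\in\mathbb R$ and $u\in\operatorname{D}(A)$ put $|u|_s=\|(A-s)u\|$. For a finite-dimensional subspace $\mathcal L\subset\operatorname{D}(A)$ of dimension $n$ and $1\le j\le n$, $$F_{\mathcal L}^j(s)=\min_{\substack{\dim V=j\\ V\subset\mathcal L}}\ \max_{0\ne u\in V}\frac{|u|_s}{\|u\|}.$$ Let $\mathbb 1_I(A)$ be the spectral projector of $A$ associated with a Borel set $I\subset\mathbb R$, so that $\operatorname{Tr}\mathbb 1_I(A)=\dim\mathbb 1_I(A)\mathcal H$ (possibly $+\infty$). Define $$\mathfrak n_j^-(t)=\sup\{s<t:\operatorname{Tr}\mathbb 1_{(s,t]}(A)\ge j\},\qquad \mathfrak n_j^+(t)=\inf\{s>t:\operatorname{Tr}\mathbb 1_{[t,s)}(A)\ge j\},$$ with $\mathfrak n_j^-(t)=-\infty$ if $\operatorname{Tr}\mathbb 1_{(-\infty,t]}(A)<j$ and $\mathfrak n_j^+(t)=+\infty$ if $\operatorname{Tr}\mathbb 1_{[t,+\infty)}(A)<j$. Statements about bounds on $\mathfrak n_j^\mp(t)$ are regarded as void in the respective one of these two cases. *)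

(* Defs.v *)
From HB Require Import structures.
From mathcomp Require Import all_boot all_order all_algebra.
From mathcomp Require Import all_classical all_reals all_analysis.
From mathcomp Require Import complex.

Set Implicit Arguments.
Unset Strict Implicit.
Unset Printing Implicit Defensive.

Import Order.TTheory GRing.Theory Num.Theory.
Import numFieldNormedType.Exports.

Local Open Scope classical_set_scope.
Local Open Scope ring_scope.

Section Dimension.
Context {K : numFieldType} {V : lmodType K}.

Definition linearly_independent (k : nat) (e : 'I_k -> V) : Prop :=
  forall c : 'I_k -> K, \sum_(i < k) c i *: e i = 0 -> forall i, c i = 0.

Definition dimension {R : realType} (S : set V) : \bar R :=
  ereal_sup [set k%:R%:E | k in [set k : nat | exists e : 'I_k -> V,
    (forall i, S (e i)) /\ linearly_independent e]].

Definition is_subspace (S : set V) : Prop := submod_closed (mem S).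

(* An everywhere defined function whose values off [dom] are never used. *)
Record operator : Type := Operator {
  dom : set V ;
  op_fun :> V -> V ;
  dom_subspace : is_subspace dom ;
  op_linear : forall (a : K) (u v : V), dom u -> dom v ->
    op_fun (a *: u + v) = a *: op_fun u + op_fun v }.

End Dimension.
Arguments operator {K} V.

Section SpectralMeasure.
Context {R : realType} {H : completeNormedModType R[i]}.
Variable dot : {dot H for Num.conj}.
Implicit Types (A : operator H) (E : set R -> {linear H -> H}).

Definition hilbert_dot : Prop := forall u : H, `|u| ^+ 2 = dot u u.

(* The right-hand side is the graph of A, the left-hand side the graph of
   the adjoint of A. *)
Definition self_adjoint A : Prop :=
  dense (dom A) /\
  forall v w : H,
    (forall u, dom A u -> dot (A u) v = dot u w) <-> (dom A v /\ w = A v).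

Definition orthogonal_projector (P : H -> H) : Prop :=
  (forall u, P (P u) = P u) /\ (forall u v, dot (P u) v = dot u (P v)).

(* The values of E on non-Borel sets are irrelevant. *)
Definition projection_valued_measure E : Prop :=
  [/\ forall I, measurable I -> orthogonal_projector (E I),
      (forall u, E set0 u = 0) /\ (forall u, E setT u = u),
      forall I J, measurable I -> measurable J ->
        forall u, E (I `&` J) u = E I (E J u)
    & forall I : (set R)^nat, (forall k, measurable (I k)) ->
        trivIset setT I ->
        forall u, series (fun k => E (I k) u) @ \oo --> E (\bigcup_k I k) u].

(* A finite measure on the Borel sets when E is a projection valued measure;
   the integral depends on its values on Borel sets only. *)
Definition quadratic_measure E (u : H) (I : set R) : \bar R :=
  (complex.Re (dot (E I u) u))%:E.

(* E is the spectral measure of A: A is the integral of the identity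
   against E, so that [E I] is the spectral projector of A for I. On a complex
   space the quadratic form on [dom A] determines A by polarization. *)
Definition spectral_measure A E : Prop :=
  [/\ projection_valued_measure E,
      forall u, dom A u <->
        (\int[quadratic_measure E u]_x (x ^+ 2)%:E < +oo)%E
    & forall u, dom A u ->
        dot (A u) u = (fine (\int[quadratic_measure E u]_x x%:E)%E)%:C%C].

End SpectralMeasure.

Section Counting.
Context {R : realType} {H : completeNormedModType R[i]}.
Implicit Types (A : operator H) (E : set R -> {linear H -> H}) (L V : set H).

(* The norm of H takes its values in the nonnegative elements of R[i]. *)
Definition rnorm (u : H) : R := complex.Re `|u|.

Definition seminorm A (s : R) (u : H) : R := rnorm (A u - s%:C%C *: u).

(* On the finite dimensional spaces where it is used, the extrema are
   attained (the outer sup over the unit sphere of V, the inf over the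
   Grassmannian of L). *)
Definition Fmin A L (j : nat) (s : R) : R :=
  inf [set sup [set seminorm A s u / rnorm u | u in [set u | V u /\ u != 0]]
      | V in [set V | [/\ is_subspace V, dimension V = j%:R%:E :> \bar R
                        & V `<=` L]]].

(* For a projector the trace is the dimension of the range. *)
Definition proj_trace (P : H -> H) : \bar R := dimension (range P).

(* The conventions -oo and +oo for an insufficient trace are those of the
   extrema of the empty set. *)
Definition n_minus E (j : nat) (t : R) : \bar R :=
  ereal_sup [set s%:E | s in [set s : R |
    s < t /\ (j%:R%:E <= proj_trace (E `]s, t]%classic))%E]].

Definition n_plus E (j : nat) (t : R) : \bar R :=
  ereal_inf [set s%:E | s in [set s : R |
    t < s /\ (j%:R%:E <= proj_trace (E `[t, s[%classic))%E]].

End Counting.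

(* Main.v *)
Require Import Defs.
From HB Require Import structures.
From mathcomp Require Import all_boot all_order all_algebra.
From mathcomp Require Import all_classical all_reals all_analysis.
From mathcomp Require Import measurable_realfun complex.
From mathcomp Require Import ring lra.

Set Implicit Arguments.
Unset Strict Implicit.
Unset Printing Implicit Defensive.

Import Order.TTheory GRing.Theory Num.Theory.
Import numFieldNormedType.Exports.

Local Open Scope classical_set_scope.
Local Open Scope ring_scope.

(** Write [F] for [Fmin A L j]. Both kinds of bounds follow from one fact: for
    every real [c], the spectral projector of any Borel set containing the
    closed interval [[c - F c, c + F c]] has rank at least [j]
    ([proj_trace_Fmin]). Applied with [c = t^-] to the sets [(s, t]] with
    [s < t^- - F t^-], and with [c = t^+] to the sets [[t, s)] with
    [s > t^+ + F t^+], it bounds [n_minus] from below and [n_plus] from above.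
    The comparison of the bounds at [t_1] and [t_2] says that [F] is 1-Lipschitz
    ([Fmin_lipschitz]), because the seminorms at [s] and [s'] differ by at most
    [|s - s'|] times the norm.

    The rank bound rests on a spectral gap ([spectral_gap]): if [u <> 0] lies in
    the domain of [A] and in the kernel of the projector of [[c - r, c + r]],
    then [|(A - c) u| > r |u|]. One splits [u = up + um] into its spectral parts
    above and below the interval and pairs [(A - c) u] with the reflected vector
    [up - um], which has the same norm as [u]; the cross terms cancel since [A]
    is symmetric, and what is left is the integral of [|x - c|] against the
    measure of [u]. The strict lower bound thus comes from the quadratic form of
    [A] and the Cauchy-Schwarz inequality.

    Were the rank less than [j], the projector would kill a nonzero vector in
    each [j]-dimensional subspace of [L], in particular in those that almost
    realize the minimum [r = F c]. This contradicts the spectral gap only if the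
    gap is uniform on the kernel of the projector in [L]. It is: the Hermitian
    form [|(A - c) u|^2 - r^2 |u|^2] is positive definite on that
    finite-dimensional space, hence bounded below by a multiple of [|u|^2]
    ([norm_bounded_by_positive_form], by orthonormalization). The uniform gap is
    what makes the closed interval, and hence the limit case [F c = |t - c|],
    accessible from near-minimizers. *)

(** * Independence, dimension and linear maps *)

Section LinearAlgebra.
Context {K : numFieldType} {V : lmodType K}.
Implicit Types (S : set V).

Lemma is_subspaceP S : is_subspace S <->
  S 0 /\ forall (a : K) u v, S u -> S v -> S (a *: u + v).
Proof.
split=> -[S0 SP]; split=> //.
- by move: S0; rewrite inE.
- by move=> a u v Su Sv; have := SP a u v; rewrite !inE; apply.
- by rewrite inE.
- by move=> a u v; rewrite !inE => Su Sv; exact: SP.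
Qed.

Lemma subspaceZ S (a : K) u : is_subspace S -> S u -> S (a *: u).
Proof.
by move=> /is_subspaceP[S0 SP] Su; have := SP a u 0 Su S0; rewrite addr0.
Qed.

Lemma subspaceD S u v : is_subspace S -> S u -> S v -> S (u + v).
Proof.
by move=> /is_subspaceP[S0 SP] Su; rewrite -[u]scale1r; exact: SP.
Qed.

Lemma subspaceB S u v : is_subspace S -> S u -> S v -> S (u - v).
Proof.
by move=> Ss Su Sv; rewrite -scaleN1r; apply: subspaceD => //; exact: subspaceZ.
Qed.

Lemma subspace_sum S k (c : 'I_k -> K) (e : 'I_k -> V) : is_subspace S ->
  (forall i, S (e i)) -> S (\sum_(i < k) c i *: e i).
Proof.
move=> Ss Se; elim/big_ind : _ => [|u v|i _]; last exact: subspaceZ.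
- by case/is_subspaceP: Ss.
- exact: subspaceD.
Qed.

Lemma linear_on_sum (W : lmodType K) S (T : V -> W) k
    (c : 'I_k -> K) (e : 'I_k -> V) : is_subspace S ->
  (forall (a : K) u v, S u -> S v -> T (a *: u + v) = a *: T u + T v) ->
  (forall i, S (e i)) ->
  T (\sum_(i < k) c i *: e i) = \sum_(i < k) c i *: T (e i).
Proof.
move=> Ss Tl Se; have S0 : S 0 by case/is_subspaceP: Ss.
have T0 : T 0 = 0.
  by have := Tl (-1) 0 0 S0 S0; rewrite scaler0 addr0 scaleN1r addNr.
elim: k c e Se => [|k IHk] c e Se; first by rewrite !big_ord0.
rewrite !big_ord_recl Tl ?IHk //; exact: subspace_sum.
Qed.


(** A coefficient vector indexed by ['I_j] is pushed forward along [h] to one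
    indexed by ['I_k], with zeros off the image. *)
Lemma linearly_independent_inj j k (h : 'I_j -> 'I_k) (e : 'I_k -> V) :
  injective h -> linearly_independent e -> linearly_independent (e \o h).
Proof.
move=> h_inj e_free c c0 i.
have <- : \sum_(l | h l == h i) c l = c i.
  by rewrite (big_pred1 i) // => l; rewrite /= (inj_eq h_inj).
apply: (e_free (fun m => \sum_(l | h l == m) c l)); rewrite -[RHS]c0.
rewrite (partition_big h xpredT) //=; apply: eq_bigr => m _.
by rewrite scaler_suml; apply: eq_bigr => l /eqP <-.
Qed.

(** A dependency is a nonzero vector in the kernel of the coefficient matrix,
    which has more rows than columns. *)
Lemma linearly_independent_leq_span j k (v : 'I_j -> V) (f : 'I_k -> V)
    (M : 'M[K]_(j, k)) :
  (forall i, v i = \sum_(l < k) M i l *: f l) ->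
  linearly_independent v -> (j <= k)%N.
Proof.
move=> vE v_free; rewrite leqNgt; apply/negP => lt_kj.
have : kermx M != 0.
  rewrite kermx_eq0 /row_free; apply: contraTneq lt_kj => <-.
  by rewrite -leqNgt rank_leq_col.
rewrite -nz_row_eq0; set x := nz_row _ => /negP; apply.
have xM0 : x *m M = 0 by apply/sub_kermxP; exact: nz_row_sub.
apply/eqP/rowP => i; rewrite mxE; apply: v_free (x 0) _ i.
under eq_bigr do rewrite vE scaler_sumr.
rewrite exchange_big big1 // => l _.
under eq_bigr do rewrite scalerA.
by have /rowP/(_ l) := xM0; rewrite !mxE -scaler_suml => ->; rewrite scale0r.
Qed.

Context {R : realType}.

Lemma dimension_ge S j (e : 'I_j -> V) : (forall i, S (e i)) ->
  linearly_independent e -> (j%:R%:E <= dimension S :> \bar R)%E.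
Proof.
move=> Se e_free; apply: ereal_sup_ubound => /=.
by exists j => //; exists e.
Qed.

Lemma dimension_geP S j : (j%:R%:E <= dimension S :> \bar R)%E <->
  exists e : 'I_j -> V, (forall i, S (e i)) /\ linearly_independent e.
Proof.
split=> [|[e [Se e_free]]]; last exact: dimension_ge e_free.
case: j => [_|j dimS]; first by exists (fun=> 0); split=> [[]|c _ []].
have [k le_jk [e [Se e_free]]] : exists2 k, (j < k)%N & exists e : 'I_k -> V,
    (forall i, S (e i)) /\ linearly_independent e.
  (* otherwise all sizes are at most j and so is their supremum *)
  apply: contrapT => nok; move: dimS; rewrite leNgt => /negP; apply.
  apply: (@le_lt_trans _ _ j%:R%:E); last by rewrite lte_fin ltr_nat.
  apply: ge_ereal_sup => _ [k Sk <-]; rewrite lee_fin ler_nat leqNgt.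
  by apply/negP => lt_jk; apply: nok; exists k.
exists (e \o widen_ord le_jk); split=> [i|]; first exact: Se.
by apply: linearly_independent_inj => // x y [/val_inj].
Qed.

Lemma dimension_leP S n : (dimension S <= n%:R%:E :> \bar R)%E <->
  forall k (e : 'I_k -> V), (forall i, S (e i)) -> linearly_independent e ->
    (k <= n)%N.
Proof.
split=> [dimS k e Se e_free|Sn].
  rewrite -(ler_nat R) -lee_fin (le_trans _ dimS) //.
  exact: dimension_ge e_free.
apply: ge_ereal_sup => _ [k [e [Se e_free]] <-]; rewrite lee_fin ler_nat.
exact: Sn e_free.
Qed.

Definition linear_span k (e : 'I_k -> V) : set V :=
  [set u | exists c : 'I_k -> K, u = \sum_(i < k) c i *: e i].

Lemma linear_span_subspace k (e : 'I_k -> V) : is_subspace (linear_span e).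
Proof.
apply/is_subspaceP; split=> [|a _ _ [c ->] [d ->]].
  by exists (fun=> 0); rewrite big1 // => i _; rewrite scale0r.
exists (fun i => a * c i + d i); rewrite scaler_sumr -big_split /=.
by apply: eq_bigr => i _; rewrite scalerDl scalerA.
Qed.

Lemma mem_linear_span k (e : 'I_k -> V) i : linear_span e (e i).
Proof.
exists (fun l => (l == i)%:R); rewrite (bigD1 i) //= eqxx scale1r.
by rewrite big1 ?addr0 // => l /negPf ->; rewrite scale0r.
Qed.

Lemma dimension_linear_span k (e : 'I_k -> V) : linearly_independent e ->
  dimension (linear_span e) = k%:R%:E :> \bar R.
Proof.
move=> e_free; apply/eqP; rewrite eq_le; apply/andP; split; last first.
  by apply: dimension_ge e_free => i; exact: mem_linear_span.
apply/dimension_leP => j v /choice[c vE].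
apply: (linearly_independent_leq_span (M := \matrix_(i, l) c i l)) => i.
by rewrite vE; apply: eq_bigr => l _; rewrite mxE.
Qed.

(** The images of an independent family remain independent, and serve as the
    witnesses of the rank. *)
Lemma dimension_range_inj (W : lmodType K) (T : {linear V -> W}) S j :
  is_subspace S -> (forall u, S u -> T u = 0 -> u = 0) ->
  (j%:R%:E <= dimension S :> \bar R)%E ->
  exists e : 'I_j -> W, (forall i, range T (e i)) /\ linearly_independent e.
Proof.
move=> Ss S_inj /dimension_geP[e [Se e_free]].
exists (T \o e); split=> [i|c]; first by exists (e i).
under eq_bigr do rewrite /= -linearZ.
move=> Tc0; apply: e_free; apply: S_inj; first exact: subspace_sum.
by rewrite linear_sum.
Qed.

End LinearAlgebra.

(** * Positive definite forms on finite-dimensional spaces *)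

Section PositiveForm.
Context {C : numClosedFieldType} {V : lmodType C} {W : normedModType C}.
Variables (S : set V) (n : nat) (Q : V -> V -> C) (T : V -> W).
Hypothesis S_sub : is_subspace S.
Hypothesis S_fin : forall k (e : 'I_k -> V), (forall i, S (e i)) ->
  linearly_independent e -> (k <= n)%N.
Hypothesis Q_linear : forall a u v w, S u -> S v -> S w ->
  Q (a *: u + v) w = a * Q u w + Q v w.
Hypothesis Q_herm : forall u v, S u -> S v -> Q v u = (Q u v)^*.
Hypothesis Q_gt0 : forall u, S u -> u != 0 -> 0 < Q u u.
Hypothesis T_linear : forall a u v, S u -> S v ->
  T (a *: u + v) = a *: T u + T v.

Let orthonormal_family k (e : 'I_k -> V) :=
  (forall i, S (e i)) /\ forall i l, Q (e i) (e l) = (i == l)%:R.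

Let Q_sum k (c : 'I_k -> C) (e : 'I_k -> V) w : (forall i, S (e i)) -> S w ->
  Q (\sum_(i < k) c i *: e i) w = \sum_(i < k) c i * Q (e i) w.
Proof.
move=> Se Sw; apply: (linear_on_sum (W := C^o) (T := Q^~ w) _ S_sub) => //.
by move=> a u v Su Sv; exact: Q_linear.
Qed.

Let Q_coord k (c : 'I_k -> C) (e : 'I_k -> V) l : orthonormal_family e ->
  Q (\sum_(i < k) c i *: e i) (e l) = c l.
Proof.
move=> [Se ee]; rewrite Q_sum // (bigD1 l) //= ee eqxx mulr1 big1 ?addr0 //.
by move=> i /negPf il; rewrite ee il mulr0.
Qed.

Let Q0l w : S w -> Q 0 w = 0.
Proof.
move=> Sw; have S0 : S 0 by case/is_subspaceP: S_sub.
by have := Q_linear (-1) S0 S0 Sw; rewrite scaler0 addr0 mulN1r addNr.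
Qed.

(** A maximal orthonormal family spans: a vector outside its span, minus its
    projection and normalized, would extend the family. *)
Let orthonormal_basis :
  exists k (e : 'I_k -> V), orthonormal_family e /\
    forall u, S u -> u = \sum_(i < k) Q u (e i) *: e i.
Proof.
pose P k := `[< exists e : 'I_k -> V, orthonormal_family e >].
have P0 : exists k, P k.
  by exists 0; apply/asboolP; exists (fun=> 0); split=> -[].
have Pn k : P k -> (k <= n)%N.
  move=> /asboolP[e e_on]; apply: (S_fin e_on.1) => c c0 l.
  by rewrite -(Q_coord c l e_on) c0 Q0l //; exact: e_on.1.
case: (ex_maxnP P0 Pn) => k /asboolP[e e_on] k_max.
exists k, e; split=> // u Su.
have [Se ee] := e_on; set p := \sum_(i < k) _.
have Sp : S p by exact: subspace_sum.
have Su' : S (u - p) by exact: subspaceB.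
apply/eqP; rewrite -subr_eq0; apply/negPn/negP => u'0.
have u'gt0 := Q_gt0 Su' u'0.
have Qu'e l : Q (u - p) (e l) = 0.
  by rewrite addrC -scaleN1r Q_linear // Q_coord // mulN1r addNr.
pose a := (sqrtC (Q (u - p) (u - p)))^-1; pose v := a *: (u - p).
have Sv : S v by exact: subspaceZ.
have QZl (b : C) x w : S x -> S w -> Q (b *: x) w = b * Q x w.
  have S0 : S 0 by case/is_subspaceP: S_sub.
  by move=> Sx Sw; have := Q_linear b Sx S0 Sw; rewrite addr0 Q0l // addr0.
have Qve l : Q v (e l) = 0 by rewrite QZl // Qu'e mulr0.
have Qvv : Q v v = 1.
  rewrite QZl // Q_herm // QZl // rmorphM /= -Q_herm // /a.
  have sgt0 : 0 < sqrtC (Q (u - p) (u - p)) by rewrite sqrtC_gt0.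
  rewrite geC0_conj ?invr_ge0 ?ltW // -[X in _ * (_ * X)]sqrtCK.
  by rewrite expr2 mulKf ?gt_eqF // mulVf ?gt_eqF.
have : P k.+1.
  apply/asboolP; exists (fun i => if unlift ord0 i is Some l then e l else v).
  split=> [i|i l]; first by case: unliftP.
  case: unliftP => [i' ->|->]; case: unliftP => [l' ->|->] //.
  by rewrite Q_herm // Qve rmorph0.
by move=> /k_max; rewrite ltnn.
Qed.

(** In an orthonormal basis the squared coordinates of [u] sum up to [Q u u], so
    each is at most that; the triangle inequality then bounds [T u]. With
    [T] the identity this is a uniform positivity of [Q] on the unit sphere, and
    with [Q] the scalar product it is the boundedness of [T]. *)
Lemma norm_bounded_by_positive_form :
  exists2 M : C, 0 <= M & forall u, S u -> `|T u| ^+ 2 <= M * Q u u.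
Proof.
have [k [e [[Se ee] e_span]]] := orthonormal_basis.
exists ((\sum_(i < k) `|T (e i)|) ^+ 2); first by rewrite exprn_ge0 // sumr_ge0.
move=> u Su.
have Quu : Q u u = \sum_(i < k) `|Q u (e i)| ^+ 2.
  rewrite {1}(e_span u Su) Q_sum //; apply: eq_bigr => i _.
  by rewrite (Q_herm Su (Se i)) normCK.
have Quu_ge0 : 0 <= Q u u by rewrite Quu sumr_ge0 // => i _; rewrite exprn_ge0.
have coord_le i : `|Q u (e i)| <= sqrtC (Q u u).
  rewrite -(ler_pXn2r (n := 2)) ?nnegrE ?sqrtC_ge0 // sqrtCK Quu.
  by rewrite (bigD1 i) //= lerDl sumr_ge0 // => l _; rewrite exprn_ge0.
rewrite -[X in _ * X]sqrtCK -exprMn.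
rewrite ler_pXn2r ?nnegrE ?mulr_ge0 ?sumr_ge0 ?sqrtC_ge0 //.
rewrite {1}(e_span u Su) (linear_on_sum _ S_sub) // mulr_suml.
apply: le_trans (ler_norm_sum _ _ _) _; apply: ler_sum => i _.
by rewrite normrZ mulrC ler_wpM2l.
Qed.

End PositiveForm.

(** * Integrals *)

Section IntegralSetFunction.
Context {R : realType}.
Import HBNNSimple.

(** The level sets of a simple function are measurable, so the values of a
    bare set function elsewhere do not enter. This passes from
    [quadratic_measure], which may be negative off the Borel sets, to measures. *)
Lemma eq_integral_set_function (m1 m2 : set R -> \bar R) (D : set R)
    (f : R -> \bar R) : (forall I, measurable I -> m1 I = m2 I) ->
  (\int[m1]_(x in D) f x = \int[m2]_(x in D) f x)%E.
Proof.
move=> m12; rewrite /integral.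
have sintE (h : {nnsfun R >-> R}) : sintegral m1 h = sintegral m2 h.
  by apply: eq_fsbigr => r _; rewrite m12.
by congr (ereal_sup _ - ereal_sup _)%E; rewrite eqEsubset; split=> _ [h hf <-];
  exists h; rewrite ?sintE.
Qed.

End IntegralSetFunction.

Section AffineIntegral.
Context {R : realType}.
Variables (mu : {measure set R -> \bar R}) (m : R).
Hypothesis mu_fin : mu setT = m%:E.
Hypothesis mu_sqr : (\int[mu]_x (x ^+ 2)%:E < +oo)%E.

Let integrable_cst (b : R) : mu.-integrable setT (EFin \o cst b).
Proof.
apply/integrableP; split; first exact/measurable_EFinP.
by rewrite (eq_integral (cst `|b|%:E)) // integral_cst // mu_fin -EFinM ltry.
Qed.

Let integrable_id : mu.-integrable setT (fun x => x%:E).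
Proof.
have sqr_int : mu.-integrable setT (fun x => (x ^+ 2)%:E).
  apply/integrableP; split; first exact/measurable_EFinP/measurable_funX.
  by under eq_integral do rewrite gee0_abs ?lee_fin ?sqr_ge0 //.
apply: le_integrable (integrableD measurableT (integrable_cst 1) sqr_int) => //.
  exact/measurable_EFinP.
move=> x _ /=; rewrite lee_fin ler_norml; apply/andP; split.
  by rewrite lerNl (le_trans _ (ler_norm _)) //; nra.
by rewrite (le_trans _ (ler_norm _)) //; nra.
Qed.

Lemma affine_integralE (a b : R) : (\int[mu]_x (a * x + b)%:E =
  (a * fine (\int[mu]_x x%:E) + b * m)%:E)%E.
Proof.
under eq_integral do rewrite EFinD EFinM.
rewrite integralD //=; last 2 first.
- exact: integrableZl.
- exact: integrable_cst.
rewrite integralZl // integral_cst //= mu_fin EFinD EFinM fineK //.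
exact: integrable_fin_num.
Qed.

(** Off the null set where the integrand is nonpositive, the integral of a
    positive function can vanish only if the measure does. *)
Lemma affine_integral_gt0 (a b : R) : 0 < m ->
  mu [set x | a * x + b <= 0] = 0%E ->
  0 < a * fine (\int[mu]_x x%:E)%E + b * m.
Proof.
move=> m_gt0; set N := [set x | _] => N0.
have mf : measurable_fun setT (fun x : R => a * x + b).
  by apply: measurable_funD => //; exact: measurable_funM.
have mN : measurable N.
  have := mf measurableT `]-oo, 0]%classic (measurable_itv _).
  by rewrite setTI set_itvE.
have f_int : mu.-integrable setT (fun x => (a * x + b)%:E).
  exact: (integrableD measurableT (integrableZl measurableT a integrable_id)
    (integrable_cst b)).
have fN_gt0 x : (setT `\` N) x -> 0 < a * x + b by rewrite ltNge => -[_ /negP].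
rewrite -lte_fin -affine_integralE (negligible_integral mN) //.
rewrite lt_def integral_ge0 => [|x /fN_gt0 /ltW //]; rewrite andbT.
apply/eqP => f0.
have : (\int[mu]_(x in setT `\` N) `|(a * x + b)%:E| = 0)%E.
  rewrite -[RHS]f0; apply: eq_integral => x /[!inE] /fN_gt0 /ltW fx0.
  by rewrite gee0_abs // lee_fin.
have mNC : measurable (setT `\` N) by exact: measurableD.
have mfN : measurable_fun (setT `\` N) (fun x => (a * x + b)%:E).
  by apply/measurable_EFinP; exact: measurable_funS mf.
move=> /(ae_eq_integral_abs _ mNC mfN) [M [mM M0 subM]].
have NM : setT `<=` N `|` M.
  move=> x _; have [Nx|Nx] := pselect (N x); [by left|right]; apply: subM => /=.
  move=> /(_ (conj I Nx)) [] f0x.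
  by have := fN_gt0 x (conj I Nx); rewrite f0x ltxx.
have mNM : measurable (N `|` M) by exact: measurableU.
have : (mu setT <= mu (N `|` M))%E by apply: le_measure NM; rewrite inE.
by rewrite measureU0 // mu_fin N0 lee_fin leNgt m_gt0.
Qed.

End AffineIntegral.

(** * Scalar products and projection-valued measures *)

Section Hilbert.
Context {R : realType} {H : completeNormedModType R[i]}.
Variable dot : {dot H for Num.conj}.
Hypothesis dotE : hilbert_dot dot.
Implicit Types (u v w : H) (E : set R -> {linear H -> H}).

Lemma normE u : `|u| = (rnorm u)%:C%C.
Proof. by rewrite /rnorm RRe_real // normr_real. Qed.

Lemma rnorm_ge0 u : 0 <= rnorm u.
Proof. by rewrite -ler0c -normE. Qed.

Lemma rnorm0 : rnorm (0 : H) = 0.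
Proof. by rewrite /rnorm normr0. Qed.

Lemma rnorm_eq0 u : (rnorm u == 0) = (u == 0).
Proof. by rewrite -[RHS]normr_eq0 normE -(inj_eq (@complexI R)). Qed.

Lemma rnorm_gt0 u : (0 < rnorm u) = (u != 0).
Proof. by rewrite lt_def rnorm_ge0 andbT rnorm_eq0. Qed.

Lemma ler_rnormD u v : rnorm (u + v) <= rnorm u + rnorm v.
Proof. by rewrite -lecR -normE rmorphD /= -!normE ler_normD. Qed.

Lemma rnormN u : rnorm (- u) = rnorm u.
Proof. by rewrite /rnorm normrN. Qed.

Lemma rnormZ (a : R) u : rnorm (a%:C%C *: u) = `|a| * rnorm u.
Proof.
apply: (@complexI R); rewrite -normE normrZ normE rmorphM /=; congr (_ * _).
by rewrite normc_def /= expr0n addr0 sqrtr_sqr.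
Qed.

(** The real part of the scalar product is a real scalar product with the same
    norm, in which inequalities can be stated over [R]. *)
Definition redot u v : R := complex.Re (dot u v).

Lemma dotC u v : dot v u = (dot u v)^*.
Proof. by rewrite hermC expr0 mul1r. Qed.

Lemma ReJ (z : R[i]) : complex.Re z^* = complex.Re z.
Proof. by case: z. Qed.

Lemma redotC u v : redot u v = redot v u.
Proof. by rewrite /redot dotC ReJ. Qed.

Lemma redot0l w : redot 0 w = 0.
Proof. by rewrite /redot linear0l. Qed.

Lemma redot0r w : redot w 0 = 0.
Proof. by rewrite redotC redot0l. Qed.

Lemma redotDl u v w : redot (u + v) w = redot u w + redot v w.
Proof.
by rewrite /redot linearDl /=; case: (dot u w) (dot v w) => [? ?] [].
Qed.

Lemma redotNl u w : redot (- u) w = - redot u w.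
Proof. by rewrite /redot linearNl /=; case: (dot u w). Qed.

Lemma redotBl u v w : redot (u - v) w = redot u w - redot v w.
Proof. by rewrite redotDl redotNl. Qed.

Lemma redotDr u v w : redot w (u + v) = redot w u + redot w v.
Proof. by rewrite !(redotC w) redotDl. Qed.

Lemma redotBr u v w : redot w (u - v) = redot w u - redot w v.
Proof. by rewrite !(redotC w) redotBl. Qed.

Lemma redotZl (a : R) u w : redot (a%:C%C *: u) w = a * redot u w.
Proof.
rewrite /redot linearZl_LR /=; case: (dot u w) => x y /=.
by rewrite mul0r subr0.
Qed.

Lemma redotZr (a : R) u w : redot w (a%:C%C *: u) = a * redot w u.
Proof. by rewrite !(redotC w) redotZl. Qed.

Lemma redot_norm u : redot u u = rnorm u ^+ 2.
Proof. by rewrite /redot -dotE normE -rmorphXn. Qed.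

Lemma dot_norm u : dot u u = (rnorm u ^+ 2)%:C%C.
Proof. by rewrite -dotE normE -rmorphXn. Qed.

(** Cauchy-Schwarz, from the nonnegativity of the squared norm of
    [|v| u - |u| v]. *)
Lemma redot_le u v : redot u v <= rnorm u * rnorm v.
Proof.
have [->|u0] := eqVneq u 0.
  by rewrite redot0l rnorm0 mul0r.
have [->|v0] := eqVneq v 0.
  by rewrite redot0r rnorm0 mulr0.
have := sqr_ge0 (rnorm ((rnorm v)%:C%C *: u - (rnorm u)%:C%C *: v)).
rewrite -redot_norm !(redotBl, redotBr) !(redotZl, redotZr) !redot_norm.
rewrite (redotC v u) => sqr_ge.
have uv0 : 0 < rnorm u * rnorm v by rewrite mulr_gt0 ?rnorm_gt0.
rewrite -(ler_pM2l uv0); nra.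
Qed.

Lemma redot_abs_le u v : `|redot u v| <= rnorm u * rnorm v.
Proof.
by rewrite ler_norml redot_le andbT lerNl -redotNl -(rnormN u) redot_le.
Qed.


Section ProjectionValuedMeasure.
Variables (E : set R -> {linear H -> H}).
Hypothesis Epvm : projection_valued_measure dot E.
Implicit Types I J : set R.

Lemma pvm0 u : E set0 u = 0.
Proof. by case: Epvm => _ [+ _] _ _; apply. Qed.

Lemma pvmT u : E setT u = u.
Proof. by case: Epvm => _ [_ +] _ _; apply. Qed.

Lemma pvmI I J u : measurable I -> measurable J -> E I (E J u) = E (I `&` J) u.
Proof. by case: Epvm => _ _ + _ mI mJ => ->. Qed.

Lemma pvm_sym I u v : measurable I -> redot (E I u) v = redot u (E I v).
Proof. by case: Epvm => + _ _ _ => /[apply] -[_ +]; rewrite /redot => ->. Qed.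

Lemma pvm_norm I u : measurable I -> redot (E I u) u = rnorm (E I u) ^+ 2.
Proof.
by move=> mI; rewrite -redot_norm [RHS]pvm_sym // pvmI // setIid redotC.
Qed.

Lemma quadratic_measureE I u : measurable I ->
  quadratic_measure dot E u I = (rnorm (E I u) ^+ 2)%:E.
Proof. by move=> /pvm_norm <-. Qed.

Lemma pvm_le I u : measurable I -> rnorm (E I u) <= rnorm u.
Proof.
move=> mI; have [->|E0] := eqVneq (E I u) 0.
  by rewrite rnorm0 rnorm_ge0.
rewrite -(ler_pM2l (x := rnorm (E I u))) ?rnorm_gt0 //.
by rewrite -expr2 -pvm_norm // redot_le.
Qed.

Lemma redot_cvg (x : nat -> H) l u : x @ \oo --> l ->
  (fun k => redot (x k) u) @ \oo --> redot l u.
Proof.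
move=> /cvgrPdist_lt xl; apply/cvgrPdist_lt => eps eps0.
have u1 : 0 < rnorm u + 1 by rewrite ltr_wpDl ?rnorm_ge0.
have := xl (eps / (rnorm u + 1))%:C%C.
rewrite ltcR divr_gt0 // => /(_ isT); apply: filterS => k.
rewrite normE ltcR ltr_pdivlMr // -redotBl => h.
apply: le_lt_trans (redot_abs_le _ _) _; apply: le_lt_trans h.
by rewrite ler_wpM2l ?rnorm_ge0 // lerDl.
Qed.

(** The squared length of [E I u] is nonnegative on all sets, measurable or
    not, as the axioms of a measure require. *)
Lemma pvm_measure u : exists mu : {measure set R -> \bar R},
  forall I, mu I = (rnorm (E I u) ^+ 2)%:E.
Proof.
pose m I := (rnorm (E I u) ^+ 2)%:E.
have m0 : m set0 = 0%E by rewrite /m pvm0 rnorm0 expr0n.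
have m_ge0 I : (0 <= m I)%E by rewrite lee_fin sqr_ge0.
have m_sigma : semi_sigma_additive m.
  move=> F mF tF mU; rewrite /m -pvm_norm //.
  have -> : (fun k => \sum_(0 <= i < k) (rnorm (E (F i) u) ^+ 2)%:E)%E =
      EFin \o (fun k => redot (series (fun i => E (F i) u) k) u).
    apply/funext => k /=; rewrite sumEFin /series /=; congr EFin.
    elim: k => [|k IHk]; first by rewrite !big_geq // /redot linear0l.
    by rewrite !big_nat_recr //= redotDl IHk pvm_norm.
  apply: cvg_EFin; first by apply: nearW.
  by apply: redot_cvg; case: Epvm => _ _ _; apply.
pose mu : {measure set R -> \bar R} := HB.pack m
  (isMeasure.Build _ _ _ m m0 m_ge0 m_sigma).
by exists mu.
Qed.

End ProjectionValuedMeasure.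
End Hilbert.

(** * Spectral gap *)

Section SpectralGap.
Context {R : realType} {H : completeNormedModType R[i]}.
Variables (dot : {dot H for Num.conj}) (A : operator H).
Variable (E : set R -> {linear H -> H}).
Hypothesis dotE : hilbert_dot dot.
Hypothesis A_sa : self_adjoint dot A.
Hypothesis AE : spectral_measure dot A E.
Implicit Types u v : H.

Let Epvm : projection_valued_measure dot E. Proof. by case: AE. Qed.

Local Notation ip := (redot dot).

(** The projectors commute and are contractions, so the measure of [E I u] is
    dominated by that of [u] and its second moment stays finite. *)
Lemma domA_spectral_projector I u : measurable I -> dom A u -> dom A (E I u).
Proof.
case: AE => _ domAE _ mI; rewrite !domAE; apply: le_lt_trans.
have [mu muE] := pvm_measure dotE Epvm u.
have [nu nuE] := pvm_measure dotE Epvm (E I u).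
rewrite (eq_integral_set_function (m2 := nu)); last first.
  by move=> J mJ; rewrite (quadratic_measureE dotE) // nuE.
rewrite [X in (_ <= X)%E](eq_integral_set_function (m2 := mu)); last first.
  by move=> J mJ; rewrite (quadratic_measureE dotE) // muE.
apply: ge0_le_measure_integral => //.
- move=> J mJ; rewrite nuE muE lee_fin ler_sqr ?nnegrE ?rnorm_ge0 //.
  by rewrite (pvmI Epvm) // setIC -(pvmI Epvm) // (pvm_le dotE Epvm).
- by move=> x; rewrite lee_fin sqr_ge0.
- exact/measurable_EFinP/measurable_funX.
Qed.

Lemma operator_symmetric u v : dom A u -> dom A v ->
  ip (A u) v = ip u (A v).
Proof.
move=> Au Av; case: A_sa => _ adj.
by rewrite /redot ((adj v (A v)).2 (conj Av erefl) u Au).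
Qed.

(** The form [s <A u, u> + b |u|^2] is the integral of [s x + b] against the
    measure of [u], hence positive if that measure lives where the integrand
    is positive. *)
Lemma spectral_form_gt0 u (s b : R) : dom A u -> u != 0 ->
  E [set x | s * x + b <= 0] u = 0 ->
  0 < s * ip (A u) u + b * rnorm u ^+ 2.
Proof.
move=> Au u0 Eu0; case: AE => _ domAE formAE.
have [mu muE] := pvm_measure dotE Epvm u.
have muE' J : measurable J -> quadratic_measure dot E u J = mu J.
  by move=> mJ; rewrite (quadratic_measureE dotE) // muE.
have -> : ip (A u) u = fine (\int[mu]_x x%:E)%E.
  by rewrite /redot formAE //= (eq_integral_set_function _ _ muE').
apply: affine_integral_gt0.
- by rewrite muE (pvmT Epvm).
- by have /domAE := Au; rewrite (eq_integral_set_function _ _ muE').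
- by rewrite exprn_gt0 // rnorm_gt0.
- by rewrite muE Eu0 rnorm0 expr0n.
Qed.

Lemma spectral_form_gt u (b : R) : dom A u -> u != 0 ->
  E `]-oo, b]%classic u = 0 -> b * rnorm u ^+ 2 < ip (A u) u.
Proof.
move=> Au u0 Eu0; rewrite -subr_gt0 -mulNr -[ip _ _]mul1r.
apply: spectral_form_gt0 => //; rewrite -[RHS]Eu0; congr (E _ u).
by apply/seteqP; split=> x /=; rewrite in_itv /= mul1r subr_le0.
Qed.

Lemma spectral_form_lt u (b : R) : dom A u -> u != 0 ->
  E `[b, +oo[%classic u = 0 -> ip (A u) u < b * rnorm u ^+ 2.
Proof.
move=> Au u0 Eu0; rewrite -subr_gt0 addrC -mulN1r.
apply: spectral_form_gt0 => //; rewrite -[RHS]Eu0; congr (E _ u).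
by apply/seteqP; split=> x /=; rewrite in_itv /= andbT mulN1r addrC subr_le0.
Qed.

Lemma spectral_projector_eq0U I J u : measurable I -> measurable J ->
  E I u = 0 -> E J u = 0 -> E (I `|` J) u = 0.
Proof.
move=> mI mJ EI0 EJ0; have [mu muE] := pvm_measure dotE Epvm u.
have mu0 K : E K u = 0 -> mu K = 0%E.
  by move=> EK0; rewrite muE EK0 rnorm0 expr0n.
have : mu (I `|` J) = 0%E by rewrite measureU0 ?mu0.
by rewrite muE => -[] /eqP; rewrite sqrf_eq0 rnorm_eq0 => /eqP.
Qed.

(** Split [u] into its parts [up] and [um] above and below the interval. The
    reflected vector [up - um] is as long as [u], and by symmetry of [A] the
    cross terms cancel in its product with [(A - c) u], which therefore
    exceeds [r |u|^2]; Cauchy-Schwarz concludes. *)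
Lemma spectral_gap (c r : R) u : dom A u -> u != 0 -> 0 <= r ->
  E `[c - r, c + r]%classic u = 0 ->
  r * rnorm u < rnorm (A u - c%:C%C *: u).
Proof.
move=> Au u0 r0 Eu0; pose J := `]c + r, +oo[%classic : set R.
have mJ : measurable J by exact: measurable_itv.
pose up := E J u; pose um := u - up.
have Aup : dom A up by exact: domA_spectral_projector.
have Aum : dom A um by exact: subspaceB (dom_subspace A) Au Aup.
have uE : u = up + um by rewrite /um addrC subrK.
have orth : ip up um = 0.
  by rewrite /um redotBr (pvm_norm dotE Epvm) // (redot_norm dotE) subrr.
have EJum : E J um = 0 by rewrite /um linearB /= (pvmI Epvm) // setIid subrr.
have EIum : E `[c - r, c + r]%classic um = 0.
  rewrite /um linearB /= Eu0 sub0r (pvmI Epvm) // (_ : _ `&` _ = set0).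
    by rewrite (pvm0 Epvm) oppr0.
  rewrite -subset0 => x []; rewrite /J /= !in_itv /= andbT ltNge.
  by move=> /andP[_ ->].
clearbody um.
have AuE : A u = A up + A um.
  by rewrite {1}uE -{1}(scale1r up) op_linear // scale1r.
have up_bound : r * rnorm up ^+ 2 <=
    ip (A up) up - c * rnorm up ^+ 2 ?= iff (up == 0).
  apply/leifP; have [->|up0] := eqVneq up 0.
    by rewrite rnorm0 expr0n !mulr0 subr0 redot0r.
  rewrite ltrBrDr -mulrDl addrC; apply: spectral_form_gt => //.
  rewrite (pvmI Epvm) // (_ : _ `&` _ = set0) ?(pvm0 Epvm) //.
  by rewrite -subset0 => x []; rewrite /J /= !in_itv /= andbT ltNge => ->.
have um_bound : r * rnorm um ^+ 2 <=
    c * rnorm um ^+ 2 - ip (A um) um ?= iff (um == 0).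
  apply/leifP; have [->|um0] := eqVneq um 0.
    by rewrite rnorm0 expr0n !mulr0 sub0r redot0r oppr0.
  rewrite ltrBrDr addrC -ltrBrDr -mulrBl; apply: spectral_form_lt => //.
  have -> : `[c - r, +oo[%classic = `[c - r, c + r]%classic `|` J.
    rewrite /J; apply/seteqP; split=> x /=; rewrite !in_itv /= !andbT.
      by move=> cx; have [xc|xc] := leP x (c + r); [left|right]; rewrite ?cx.
    by case=> [/andP[]//|]; lra.
  exact: spectral_projector_eq0U.
have norm_uE : rnorm u ^+ 2 = rnorm up ^+ 2 + rnorm um ^+ 2.
  rewrite -!(redot_norm dotE) {1 2}uE !(redotDl, redotDr).
  by rewrite (redotC dot um) orth; ring.
have norm_reflect : rnorm (up - um) = rnorm u.
  apply/eqP; rewrite -(eqrXn2 (n := 2)) ?rnorm_ge0 // norm_uE.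
  rewrite -!(redot_norm dotE) !(redotBl, redotBr) (redotC dot um) orth.
  by apply/eqP; ring.
have prodE : ip (A u - c%:C%C *: u) (up - um) =
    (ip (A up) up - c * rnorm up ^+ 2) +
    (c * rnorm um ^+ 2 - ip (A um) um).
  rewrite AuE {1}uE -!(redot_norm dotE).
  rewrite !(redotBl, redotBr, redotDl, redotZl, redotDr).
  rewrite (redotC dot um up) orth (operator_symmetric Aum Aup).
  rewrite (redotC dot um (A up)); ring.
have r_lt : r * rnorm u ^+ 2 < ip (A u - c%:C%C *: u) (up - um).
  rewrite prodE norm_uE mulrDr.
  have [up0|up0] := eqVneq up 0.
    apply: ler_ltD; first by rewrite up_bound.
    rewrite (lt_leif um_bound); apply: contra u0 => /eqP um0.
    by rewrite uE up0 um0 addr0.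
  by apply: ltr_leD; [rewrite (lt_leif up_bound)|rewrite um_bound].
have u_gt0 : 0 < rnorm u by rewrite rnorm_gt0.
rewrite -(ltr_pM2r u_gt0) -mulrA -expr2 (lt_le_trans r_lt) //.
by rewrite -norm_reflect redot_le.
Qed.

End SpectralGap.

(** * Minimax values *)

Section Minimax.
Context {R : realType} {H : completeNormedModType R[i]}.
Variables (dot : {dot H for Num.conj}) (A : operator H) (L : set H) (n j : nat).
Hypothesis dotE : hilbert_dot dot.
Hypothesis L_sub : is_subspace L.
Hypothesis L_dim : dimension L = n%:R%:E :> \bar R.
Hypothesis L_dom : L `<=` dom A.
Hypothesis j_gt0 : (1 <= j)%N.
Hypothesis j_le_n : (j <= n)%N.
Implicit Types (u : H) (V : set H) (s : R).

Let shifted s u := A u - s%:C%C *: u.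

Let shifted_linear s (a : R[i]) u v : dom A u -> dom A v ->
  shifted s (a *: u + v) = a *: shifted s u + shifted s v.
Proof.
move=> Au Av; rewrite /shifted op_linear // scalerDr scalerBr !scalerA.
by rewrite [s%:C%C * a]mulrC opprD addrACA.
Qed.

Let fin_dim V : V `<=` L -> forall k (e : 'I_k -> H), (forall i, V (e i)) ->
  linearly_independent e -> (k <= n)%N.
Proof.
move=> VL k e Ve.
have /dimension_leP Ln : (dimension L <= n%:R%:E :> \bar R)%E by rewrite L_dim.
by apply: Ln => i; exact/VL/Ve.
Qed.

Lemma seminorm_ge0 s u : 0 <= seminorm A s u.
Proof. exact: rnorm_ge0. Qed.

Lemma seminorm_shift s s' u :
  seminorm A s' u <= seminorm A s u + `|s' - s| * rnorm u.
Proof.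
rewrite -[`|_|]normrN -rnormZ /seminorm (le_trans _ (ler_rnormD _ _)) //.
by rewrite opprB rmorphB scalerBl addrA subrK.
Qed.

(** Linear maps are bounded on finite-dimensional spaces. The supremum of an
    unbounded set of reals being 0 by convention, this bound is what makes the
    suprema in [Fmin] dominate the quotients. *)
Lemma seminorm_bounded s :
  exists B : R, forall u, L u -> seminorm A s u <= B * rnorm u.
Proof.
have [||||M M0 MB] := norm_bounded_by_positive_form (Q := dot) (T := shifted s)
  L_sub (fin_dim (@subset_refl _ L)).
- by move=> a u v w _ _ _; rewrite linearPl.
- by move=> u v _ _; exact: dotC.
- by move=> u _ u0; rewrite dnorm_gt0.
- by move=> a u v Lu Lv; apply: shifted_linear; exact: L_dom.
exists (Num.sqrt (complex.Re M)) => u Lu.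
have ME : M = (complex.Re M)%:C%C by rewrite RRe_real // ger0_real.
have ReM_ge0 : 0 <= complex.Re M by rewrite -ler0c -ME.
rewrite -ler_sqr ?nnegrE ?seminorm_ge0 ?mulr_ge0 ?sqrtr_ge0 ?rnorm_ge0 //.
rewrite exprMn sqr_sqrtr // -lecR rmorphXn rmorphM /= -ME -(dot_norm dotE).
by rewrite /seminorm -normE; exact: MB.
Qed.

Let admissible V :=
  [/\ is_subspace V, dimension V = j%:R%:E :> \bar R & V `<=` L].

Let quotients s V :=
  [set seminorm A s u / rnorm u | u in [set u | V u /\ u != 0]].

Lemma admissible_neq0 V : admissible V -> exists2 u, V u & u != 0.
Proof.
case=> Vs /esym/eqP; rewrite eq_le => /andP[/dimension_geP[e [Ve e_free]] _] _.
case: j j_gt0 e Ve e_free => // k _ e Ve e_free; exists (e ord0) => //.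
apply/eqP => e0; have /eqP := oner_neq0 R[i]; apply.
pose c (i : 'I_k.+1) : R[i] := (i == ord0)%:R.
have <- : c ord0 = 1 by rewrite /c eqxx.
apply: e_free; rewrite big1 // => i _; rewrite /c; case: eqP => [->|_].
  by rewrite e0 scaler0.
by rewrite scale0r.
Qed.

Lemma admissible_exists : exists V, admissible V.
Proof.
have /dimension_geP[e [Le e_free]] : (j%:R%:E <= dimension L :> \bar R)%E.
  by rewrite L_dim lee_fin ler_nat.
exists (linear_span e); split; first exact: linear_span_subspace.
- exact: dimension_linear_span.
- by move=> _ [c ->]; exact: subspace_sum.
Qed.

Let sup_quotients_ge0 s V : admissible V -> 0 <= sup (quotients s V).
Proof.
move=> Va; have [u Vu u0] := admissible_neq0 Va.
have [_ _ VL] := Va; have [B LB] := seminorm_bounded s.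
apply: (@le_trans _ _ (seminorm A s u / rnorm u)).
  by rewrite divr_ge0 ?rnorm_ge0 ?seminorm_ge0.
apply: ub_le_sup; last by exists u.
by exists B => _ [v [Vv v0] <-]; rewrite ler_pdivrMr ?rnorm_gt0 //; exact/LB/VL.
Qed.

Let FminE s : Fmin A L j s = inf [set sup (quotients s V) | V in admissible].
Proof. by []. Qed.

Let Fmin_lbound s : has_lbound [set sup (quotients s V) | V in admissible].
Proof. by exists 0 => _ [V Va <-]; exact: sup_quotients_ge0. Qed.

Lemma Fmin_ge0 s : 0 <= Fmin A L j s.
Proof.
rewrite FminE; apply: lb_le_inf.
  by have [V Va] := admissible_exists; exists (sup (quotients s V)), V.
by move=> _ [V Va <-]; exact: sup_quotients_ge0.
Qed.

Lemma Fmin_le s V (M : R) : admissible V ->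
  (forall u, V u -> seminorm A s u <= M * rnorm u) -> Fmin A L j s <= M.
Proof.
move=> Va VM; rewrite FminE; apply: (@le_trans _ _ (sup (quotients s V))).
  by apply: ge_inf; [exact: Fmin_lbound|exists V].
have [u Vu u0] := admissible_neq0 Va.
apply: ge_sup; first by exists (seminorm A s u / rnorm u), u.
by move=> _ [v [Vv v0] <-]; rewrite ler_pdivrMr ?rnorm_gt0 //; exact: VM.
Qed.

(** The infimum over subspaces is approached by the supremum over one of them,
    and that supremum bounds each quotient. *)
Lemma Fmin_near_minimizer s (eps : R) : 0 < eps -> exists V, admissible V /\
  forall u, V u -> seminorm A s u <= (Fmin A L j s + eps) * rnorm u.
Proof.
move=> eps0; have F_inf : has_inf [set sup (quotients s V) | V in admissible].
  split; last exact: Fmin_lbound.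
  by have [V Va] := admissible_exists; exists (sup (quotients s V)), V.
have [_ [V Va <-] VF] := inf_adherent eps0 F_inf.
exists V; split=> // u Vu; have [->|u0] := eqVneq u 0.
  have [B LB] := seminorm_bounded s; have L0 : L 0 by case/is_subspaceP: L_sub.
  by have := LB 0 L0; rewrite rnorm0 !mulr0.
rewrite -ler_pdivrMr ?rnorm_gt0 // (le_trans _ (ltW VF)) //.
have [_ _ VL] := Va; have [B LB] := seminorm_bounded s.
apply: ub_le_sup; last by exists u.
by exists B => _ [v [Vv v0] <-]; rewrite ler_pdivrMr ?rnorm_gt0 //; exact/LB/VL.
Qed.

Lemma Fmin_lipschitz s s' : Fmin A L j s' <= Fmin A L j s + `|s' - s|.
Proof.
apply/ler_addgt0Pr => eps eps0.
have [V [Va VF]] := Fmin_near_minimizer s eps0.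
apply: (Fmin_le Va) => u Vu; apply: le_trans (seminorm_shift s s' u) _.
by rewrite addrAC mulrDl lerD2r VF.
Qed.

Variable E : set R -> {linear H -> H}.
Hypothesis A_sa : self_adjoint dot A.
Hypothesis AE : spectral_measure dot A E.

(** The kernel of [E I] in [L] carries the form [|(A - c) u|^2 - r^2 |u|^2],
    positive by [spectral_gap] and hence bounded below by a multiple of
    [|u|^2]. If the rank were below [j], that kernel would meet every
    [j]-dimensional subspace, in particular one that almost attains the
    minimum [r], where the form takes values too small for that bound. *)
Lemma proj_trace_Fmin (c : R) (I : set R) : measurable I ->
  `[c - Fmin A L j c, c + Fmin A L j c]%classic `<=` I ->
  (j%:R%:E <= proj_trace (E I) :> \bar R)%E.
Proof.
set r := Fmin A L j c => mI cI.
have Epvm : projection_valued_measure dot E by case: AE.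
apply/dimension_geP; apply: contrapT => rank_lt_j.
have r_ge0 : 0 <= r by exact: Fmin_ge0.
pose K : set H := [set u | L u /\ E I u = 0].
have K_sub : is_subspace K.
  apply/is_subspaceP; split=> [|a u v [Lu Eu] [Lv Ev]].
    by split; [case/is_subspaceP: L_sub|rewrite linear0].
  split; last by rewrite linearP Eu Ev scaler0 addr0.
  by apply: subspaceD => //; exact: subspaceZ.
have KL : K `<=` L by move=> u [].
pose Q u v := dot (shifted c u) (shifted c v) - (r ^+ 2)%:C%C * dot u v.
have Q_linear a u v w : K u -> K v -> K w ->
    Q (a *: u + v) w = a * Q u w + Q v w.
  move=> [Lu _] [Lv _] [Lw _].
  rewrite /Q shifted_linear ?linearPl /=; [|exact: L_dom..].
  ring.
have Q_herm u v : K u -> K v -> Q v u = (Q u v)^*.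
  have rJ : ((r ^+ 2)%:C%C)^* = (r ^+ 2)%:C%C.
    by rewrite geC0_conj // ler0c sqr_ge0.
  move=> _ _; rewrite /Q rmorphB [X in _ = _ - X]rmorphM /= rJ.
  by rewrite (dotC dot (shifted c u)) (dotC dot u).
have QE u : Q u u = (seminorm A c u ^+ 2 - r ^+ 2 * rnorm u ^+ 2)%:C%C.
  by rewrite /Q !(dot_norm dotE) rmorphB [X in _ = _ - X]rmorphM.
have Q_gt0 u : K u -> u != 0 -> 0 < Q u u.
  move=> [Lu Eu] u0; rewrite QE ltcR subr_gt0 -exprMn ltr_sqr ?nnegrE;
    rewrite ?mulr_ge0 ?rnorm_ge0 //.
  apply: (spectral_gap dotE A_sa AE) => //; first exact: L_dom.
  by rewrite -(setIidl cI) -(pvmI Epvm) // Eu linear0.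
have [M M0 MB] := norm_bounded_by_positive_form (T := id) K_sub (fin_dim KL)
  Q_linear Q_herm Q_gt0 (fun a u v _ _ => erefl).
pose m := complex.Re M.
have ME : M = m%:C%C by rewrite RRe_real // ger0_real.
have m_ge0 : 0 <= m by rewrite -ler0c -ME.
have {}MB u : K u ->
    rnorm u ^+ 2 <= m * (seminorm A c u ^+ 2 - r ^+ 2 * rnorm u ^+ 2).
  by move=> /MB; rewrite normE QE ME -rmorphXn -rmorphM lecR.
(* chosen so that m * ((r + eps) ^ 2 - r ^ 2) < 1 *)
pose eps := ((m + 1) * (2 * r + 2))^-1.
have eps_gt0 : 0 < eps by rewrite invr_gt0 mulr_gt0 //; lra.
have [V [[Vs Vdim VL] VF]] := Fmin_near_minimizer c eps_gt0.
have [v [Vv Ev v0]] : exists v, [/\ V v, E I v = 0 & v != 0].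
  apply: contrapT => noV; apply: rank_lt_j.
  apply: (dimension_range_inj (S := V) (R := R)) => //; last by rewrite Vdim.
  move=> u Vu Eu; apply: contrapT => u0.
  by apply: noV; exists u; split=> //; apply/eqP.
have v_gt0 : 0 < rnorm v by rewrite rnorm_gt0.
have := MB v (conj (VL v Vv) Ev); apply/negP; rewrite -ltNge.
have sem_sqr : seminorm A c v ^+ 2 <= (r + eps) ^+ 2 * rnorm v ^+ 2.
  rewrite -exprMn ler_sqr ?nnegrE ?seminorm_ge0 //; first exact: VF.
  by rewrite mulr_ge0 ?rnorm_ge0 // addr_ge0 // ltW.
have eps_def : eps * ((m + 1) * (2 * r + 2)) = 1.
  by rewrite mulVf // gt_eqF // mulr_gt0 //; lra.
have small : m * ((r + eps) ^+ 2 - r ^+ 2) < 1.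
  have eps_le1 : eps <= 1 by rewrite invf_le1 ?mulr_gt0 //; nra.
  have sqr_le : (r + eps) ^+ 2 - r ^+ 2 <= eps * (2 * r + 2) by nra.
  apply: le_lt_trans (ler_wpM2l m_ge0 sqr_le) _.
  have -> : m * (eps * (2 * r + 2)) =
      eps * ((m + 1) * (2 * r + 2)) - eps * (2 * r + 2) by ring.
  rewrite eps_def.
  by rewrite ltrBlDr ltrDl mulr_gt0 //; lra.
apply: (@le_lt_trans _ _ (m * ((r + eps) ^+ 2 - r ^+ 2) * rnorm v ^+ 2)).
  by rewrite -mulrA ler_wpM2l // mulrBl lerB.
by rewrite gtr_pMl // exprn_gt0.
Qed.

End Minimax.

(** * Bounds on the spectrum *)

Theorem proposition1 (R : realType) (H : completeNormedModType R[i])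
    (dot : {dot H for Num.conj}) (dotE : hilbert_dot dot)
    (A : operator H) (A_sa : self_adjoint dot A)
    (E : set R -> {linear H -> H}) (AE : spectral_measure dot A E)
    (L : set H) (n : nat) (L_sub : is_subspace L)
    (L_dim : dimension L = n%:R%:E :> \bar R) (L_dom : L `<=` dom A)
    (j : nat) (j_gt0 : (1 <= j)%N) (j_le_n : (j <= n)%N) (t : R) :
  [/\ forall tm : R, tm < t ->
        Fmin A L j tm <= t - tm ->
        (j%:R%:E <= proj_trace (E `]-oo, t]%classic))%E ->
        ((tm - Fmin A L j tm)%:E <= n_minus E j t)%E,
      forall tp : R, t < tp ->
        Fmin A L j tp <= tp - t ->
        (j%:R%:E <= proj_trace (E `[t, +oo[%classic))%E ->
        ((tp + Fmin A L j tp)%:E >= n_plus E j t)%E,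
      forall tm1 tm2 : R, tm1 < tm2 -> tm2 < t ->
        Fmin A L j tm1 <= t - tm1 -> Fmin A L j tm2 <= t - tm2 ->
        tm1 - Fmin A L j tm1 <= tm2 - Fmin A L j tm2 /\
        ((j%:R%:E <= proj_trace (E `]-oo, t]%classic))%E ->
         ((tm2 - Fmin A L j tm2)%:E <= n_minus E j t)%E)
    & forall tp1 tp2 : R, t < tp2 -> tp2 < tp1 ->
        Fmin A L j tp1 <= tp1 - t -> Fmin A L j tp2 <= tp2 - t ->
        tp1 + Fmin A L j tp1 >= tp2 + Fmin A L j tp2 /\
        ((j%:R%:E <= proj_trace (E `[t, +oo[%classic))%E ->
         ((tp2 + Fmin A L j tp2)%:E >= n_plus E j t)%E)].
Proof.
have Fge0 s : 0 <= Fmin A L j s.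
  by apply: (Fmin_ge0 (dot := dot) (n := n)).
have rank_ge c I : measurable I ->
    `[c - Fmin A L j c, c + Fmin A L j c]%classic `<=` I ->
    (j%:R%:E <= proj_trace (E I) :> \bar R)%E.
  by move=> mI; apply: (proj_trace_Fmin (dot := dot) (n := n)).
have lipschitz s s' : Fmin A L j s' <= Fmin A L j s + `|s' - s|.
  by apply: (Fmin_lipschitz (dot := dot) (n := n)).
have lower tm : tm < t -> Fmin A L j tm <= t - tm ->
    ((tm - Fmin A L j tm)%:E <= n_minus E j t)%E.
  move=> tmt Fle; apply/lee_subgt0Pr => eps eps0; rewrite -EFinB.
  have Ftm := Fge0 tm.
  apply: ereal_sup_ubound; exists (tm - Fmin A L j tm - eps) => //=.
  split; first by lra.
  apply: (rank_ge tm); first exact: measurable_itv.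
  by move=> x /=; rewrite !in_itv /= => /andP[? ?]; apply/andP; split; lra.
have upper tp : t < tp -> Fmin A L j tp <= tp - t ->
    ((tp + Fmin A L j tp)%:E >= n_plus E j t)%E.
  move=> tpt Fle; apply/lee_addgt0Pr => eps eps0; rewrite -EFinD.
  have Ftp := Fge0 tp.
  apply: ereal_inf_lbound; exists (tp + Fmin A L j tp + eps) => //=.
  split; first by lra.
  apply: (rank_ge tp); first exact: measurable_itv.
  by move=> x /=; rewrite !in_itv /= => /andP[? ?]; apply/andP; split; lra.
split=> [tm tmt Fle _|tp tpt Fle _|tm1 tm2 tm12 tm2t _ F2|
  tp1 tp2 tp2t tp12 _ F2].
- exact: lower.
- exact: upper.
- split=> [|_]; last exact: lower.
  by have := lipschitz tm1 tm2; rewrite gtr0_norm ?subr_gt0 //; lra.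
- split=> [|_]; last exact: upper.
  by have := lipschitz tp1 tp2; rewrite distrC gtr0_norm ?subr_gt0 //; lra.
Qed.
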